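(* For a convex cone $E_+$ in a real topological vector space $E$, the following are equivalent: (i) The topological dual cone $E'_+$ separates points on $E$; (ii) The topological dual space $E'$ separates points on $E$ and the weak closure $\overline{E_+}^{\,w}$ is a proper cone; (iii) The intersection of all closed supporting hyperplanes of $E_+$ is $\{0\}$; (iv) There is a weaker (i.e. coarser) locally convex topology on $E$ for which $E_+$ is normal; (v) There is a topological space $\Omega$ and an injective positive representation $E \to C_p(\Omega)$; (vi) There is a locally compact Hausdorff space $\Omega$ and an injective positive representation $E \to C_k(\Omega)$. Furthermore, if $E$ is a normed space, then (when these equivalent conditions hold) the topology in (iv) can be taken normable, and the space $\Omega$ in (vi) can be taken compact.
   Context: All vector spaces are real and all topological vector spaces (including locally convex spaces) are Hausdorff; ''weaker'' is not meant strictly. A convex cone is a non-empty subset $\mathcal{K}$ with $\mathcal{K}+\mathcal{K}\subseteq\mathcal{K}$ and $\lambda\mathcal{K}\subseteq\mathcal{K}$ for all $\lambda\ge0$; it is proper if $\mathcal{K}\cap-\mathcal{K}=\{0\}$. $E$ is preordered by $x\le y \iff y-x\in E_+$. $E'$ is the topological dual of $E$ and $E'_+$ is the set of continuous linear functionals that are non-negative on $E_+$. A set $S$ of functionals separates points on $E$ if for every $x\neq 0$ there is $\varphi\in S$ with $\varphi(x)\neq0$. The weak closure is the closure for $\sigma(E,E')$. A supporting hyperplane of $E_+$ is an affine hyperplane $H=\{x\in E:\varphi(x)=\alpha\}$, with $\varphi$ a non-zero linear functional on $E$ and $\alpha\in\mathbb{R}$, such that $E_+\subseteq\{x:\varphi(x)\ge\alpha\}$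 and $E_+\cap H\neq\emptyset$. The intersection of an empty family of hyperplanes is $E$. The cone $E_+$ is normal for a locally convex topology if this topology has a base of $0$-neighbourhoods $U$ that are full (i.e. $x\le y\le z$ with $x,z\in U$ implies $y\in U$); equivalently, the topology is generated by a family of seminorms $\rho$ that are monotone ($0\le x\le y$ implies $\rho(x)\le\rho(y)$). $C_p(\Omega)$ and $C_k(\Omega)$ denote the space $C(\Omega)$ of continuous functions $\Omega\to\mathbb{R}$ with the topology of pointwise convergence, respectively of compact convergence (uniform convergence on compact subsets), with the cone of everywhere non-negative functions. A representation is a continuous linear map from $E$ to such a space. A linear map $T:E\to F$ is positive if $T[E_+]\subseteq F_+$. *)

(* Defs.v *)
From HB Require Import structures.
From mathcomp Require Import all_boot all_order all_algebra.
From mathcomp Require Import all_classical all_reals.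
From mathcomp Require Import convex topology normedtype.

Set Implicit Arguments.
Unset Strict Implicit.
Unset Printing Implicit Defensive.

Import Order.TTheory GRing.Theory Num.Theory.
Import numFieldNormedType.Exports.

Local Open Scope classical_set_scope.
Local Open Scope ring_scope.

(* [topologicalLmodType R] (continuous addition and scaling, no local
   convexity) is the type of topological vector spaces; [tvsType] is locally
   convex. Neither includes the Hausdorff property. *)

Section Cones.
Context {R : realType} {E : lmodType R}.
Implicit Types (K C U : set E).

Definition convex_cone K :=
  [/\ K !=set0,
      (forall x y, K x -> K y -> K (x + y)) &
      (forall (a : R) x, 0 <= a -> K x -> K (a *: x))].

Definition proper_cone K :=
  convex_cone K /\ K `&` [set - x | x in K] = [set 0].

Definition cone_le C (x y : E) := C (y - x).

Definition full_set C U :=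
  forall x y z, cone_le C x y -> cone_le C y z -> U x -> U z -> U y.

Definition separates_points (S : set {scalar E}) :=
  forall x : E, x != 0 -> exists2 phi, S phi & phi x != 0.

Definition supporting_hyperplane C (H : set E) :=
  exists (phi : {scalar E}) (alpha : R),
    [/\ exists x, phi x != 0,
        H = [set x | phi x = alpha],
        C `<=` [set x | alpha <= phi x] &
        C `&` H !=set0].

End Cones.

Section Duals.
Context {R : realType}.

Definition top_dual (E : preTopologicalLmodType R) : set {scalar E} :=
  [set phi : {scalar E} | continuous (phi : E -> R)].

Definition top_dual_cone (E : preTopologicalLmodType R) (C : set E) :
    set {scalar E} :=
  [set phi | top_dual phi /\ forall x, C x -> 0 <= phi x].

(* E endowed with sigma(E, E'), the supremum of the initial topologies of the
   continuous linear functionals. *)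
Definition weakly (E : preTopologicalLmodType R) : Type := E.

HB.instance Definition _ (E : preTopologicalLmodType R) :=
  Topological.copy (weakly E)
    (sup_topology (fun phi : {phi : {scalar E} | top_dual phi} =>
       Topological.class (initial_topology (projT1 phi : E -> R)))).

Definition weak_closure (E : preTopologicalLmodType R) (C : set E) : set E :=
  @closure (weakly E) C.

(* A base of neighbourhoods of 0 consists of full sets. *)
Definition normal_cone (E : preTopologicalLmodType R) (C : set E) :=
  forall V : set E, nbhs (0 : E) V ->
    exists U : set E, [/\ nbhs (0 : E) U, full_set C U & U `<=` V].

(* The topology of F is locally convex and Hausdorff: the first three clauses
   are the fields of the library's factory for [tvsType]. *)
Definition locally_convex_space (F : preTopologicalLmodType R) :=
  [/\ continuous (fun z : F * F => z.1 + z.2),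
      continuous (fun z : R^o * F => z.1 *: z.2),
      (exists2 B : set_system F,
         (forall b, b \in B -> convex_set b) & basis B) &
      hausdorff_space F].

Definition is_norm (E : lmodType R) (p : E -> R) :=
  [/\ forall x, 0 <= p x,
      forall x, p x = 0 -> x = 0,
      forall (a : R) x, p (a *: x) = `|a| * p x &
      forall x y, p (x + y) <= p x + p y].

Definition normable (F : preTopologicalLmodType R) :=
  exists2 p : F -> R, is_norm p &
    forall A : set F, open A <->
      forall x, A x -> exists2 r : R, 0 < r & [set y | p (y - x) < r] `<=` A.

End Duals.

Record topology_on (T : Type) := TopologyOn {
  opens :> set_system T;
  opens_setT : opens setT;
  opens_setI : setI_closed opens;
  opens_bigcup : forall (I : Type) (f : I -> set T),
    (forall i, opens (f i)) -> opens (\bigcup_i f i) }.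

(* T endowed with the topology tau, whatever topology it already carries. *)
Definition retopologized (T : Type) (tau : topology_on T) : Type := T.

HB.instance Definition _ (T : choiceType) (tau : topology_on T) :=
  Choice.copy (retopologized tau) T.
HB.instance Definition _ (T : choiceType) (tau : topology_on T) :=
  isOpenTopological.Build (retopologized tau)
    (opens_setT tau) (@opens_setI _ tau) (@opens_bigcup _ tau).
HB.instance Definition _ (R : realType) (E : lmodType R)
    (tau : topology_on E) := GRing.Lmodule.copy (retopologized tau) E.

Definition coarser_than (T : topologicalType) (tau : topology_on T) :=
  forall A : set T, opens tau A -> open A.

Section ContinuousFunctions.
Context {R : realType} {Omega : topologicalType}.
Notation C := (continuousType Omega R).
Implicit Types f g h : C.

Let cts_add f g : continuous (fun w => f w + g w).
Proof. by move=> w; apply: cvgD; exact: cts_fun. Qed.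

Let cts_opp f : continuous (fun w => - f w).
Proof. by move=> w; apply: cvgN; exact: cts_fun. Qed.

Let cts_scale (a : R) f : continuous (fun w => a * f w).
Proof. by move=> w; apply: cvgM; [exact: cvg_cst|exact: cts_fun]. Qed.

Definition C_zero : C := cst 0.
Definition C_add f g : C := mkcts (@cts_add f g).
Definition C_opp f : C := mkcts (@cts_opp f).
Definition C_scale (a : R) f : C := mkcts (@cts_scale a f).

Let C_addA : associative C_add.
Proof. by move=> f g h; apply/continuousEP => w; exact: addrA. Qed.

Let C_addC : commutative C_add.
Proof. by move=> f g; apply/continuousEP => w; exact: addrC. Qed.

Let C_add0 : left_id C_zero C_add.
Proof. by move=> f; apply/continuousEP => w; exact: add0r. Qed.

Let C_addN : left_inverse C_zero C_opp C_add.
Proof. by move=> f; apply/continuousEP => w; exact: addNr. Qed.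

HB.instance Definition _ := GRing.isZmodule.Build C C_addA C_addC C_add0 C_addN.

Let C_scaleA a b f : C_scale a (C_scale b f) = C_scale (a * b) f.
Proof. by apply/continuousEP => w; exact: mulrA. Qed.

Let C_scale1 : left_id 1 C_scale.
Proof. by move=> f; apply/continuousEP => w; exact: mul1r. Qed.

Let C_scaleDr : right_distributive C_scale +%R.
Proof. by move=> a f g; apply/continuousEP => w; exact: mulrDr. Qed.

Let C_scaleDl f : {morph C_scale^~ f : a b / a + b}.
Proof. by move=> a b; apply/continuousEP => w; exact: mulrDl. Qed.

HB.instance Definition _ := GRing.Zmodule_isLmodule.Build R C
  C_scaleA C_scale1 C_scaleDr C_scaleDl.

End ContinuousFunctions.

(* C(Omega) with the topology of pointwise, resp. compact, convergence. *)
Definition Cp (R : realType) (Omega : topologicalType) : Type :=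
  continuousType Omega R.
Definition Ck (R : realType) (Omega : topologicalType) : Type :=
  continuousType Omega R.

HB.instance Definition _ (R : realType) (Omega : topologicalType) :=
  GRing.Lmodule.copy (Cp R Omega) (continuousType Omega R).
HB.instance Definition _ (R : realType) (Omega : topologicalType) :=
  Topological.copy (Cp R Omega)
    (initial_topology
       ((fun f => f) : continuousType Omega R -> {ptws Omega -> R})).

HB.instance Definition _ (R : realType) (Omega : topologicalType) :=
  GRing.Lmodule.copy (Ck R Omega) (continuousType Omega R).
HB.instance Definition _ (R : realType) (Omega : topologicalType) :=
  Topological.copy (Ck R Omega)
    (initial_topology
       ((fun f => f) : continuousType Omega R -> {family compact, Omega -> R})).

Definition nonneg_functions (R : realType) (Omega : topologicalType) :
    set (continuousType Omega R) :=
  [set f | forall w, 0 <= f w].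

Definition injective_positive_representation (R : realType)
    (E F : preTopologicalLmodType R) (T : {linear E -> F})
    (EC : set E) (FC : set F) :=
  [/\ continuous T, injective T & T @` EC `<=` FC].

(* Main.v *)
Require Import Defs.
From HB Require Import structures.
From mathcomp Require Import all_boot all_order all_algebra.
From mathcomp Require Import all_classical all_reals.
From mathcomp Require Import interval_inference convex topology normedtype.
From mathcomp Require Import ring lra.

Set Implicit Arguments.
Unset Strict Implicit.
Unset Printing Implicit Defensive.

Import Order.TTheory GRing.Theory Num.Theory.
Import numFieldNormedType.Exports.
Local Open Scope classical_set_scope.
Local Open Scope ring_scope.

(** The dual cone is the common source of all the structures in the statement,
    and a separation argument leads from each of them back to it.

    Suppose the dual cone [E'_+] separates points. Its members are non-negative
    on the weak closure of [E_+], so that closure contains no line; their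
    kernels are closed supporting hyperplanes; the seminorms
    [fun x => `|f x|], for [f] in [E'_+], satisfy
    [`|f y| <= max `|f x| `|f z|] on order intervals [x <= y <= z] and
    therefore define a topology for which [E_+] is normal; and evaluation maps
    [E] into the functions on [E'_+]. For the last point any topology on [E'_+]
    may be chosen that makes the evaluations continuous. The discrete one is
    locally compact, and its compact sets are finite, so the topologies of
    compact and of pointwise convergence agree and continuity is immediate.

    Conversely, representations give functionals by evaluation at points, and a
    closed supporting hyperplane of a cone passes through [0] and is the kernel
    of a positive functional, which is continuous because its kernel is closed.
    If the weak closure of [E_+] is proper, or if [E_+] is normal for a coarser
    locally convex topology, then for each [x != 0] one of [x] and [- x] lies at
    positive distance from [E_+], measured by a continuous seminorm in the first
    case ([notin_weak_closure]) and by the gauge of a convex neighbourhood of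
    [0] in the second ([normal_cone_gap]). In both cases [cone_separation]
    yields a functional that is non-negative on [E_+], negative at that point
    and dominated by the given sublinear functional, hence continuous.

    The separation is an instance of the Hahn-Banach theorem ([hahn_banach]),
    proved here by means of minimal sublinear functionals: Zorn's lemma provides
    a minimal sublinear functional below a given one, and minimality forces
    linearity. One operation, [cone_relax], is used both to show this and to
    impose lower bounds on a cone.

    For a normed space [E'_+] is replaced by its intersection with the dual unit
    ball. The supremum of [`|f x|] over it is a norm with full balls, and with
    the topology of pointwise convergence it is compact by Tychonoff's theorem. *)

(** * Sublinear functionals and the Hahn-Banach theorem *)

Section HahnBanach.
Context {R : realType} {E : lmodType R}.
Implicit Types (p q : E -> R) (D : set (E * R^o)%type).

Definition sublinear p :=
  (forall (a : R) x, 0 <= a -> p (a *: x) = a * p x) /\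
  (forall x y, p (x + y) <= p x + p y).

Lemma sublinear0 p : sublinear p -> p 0 = 0.
Proof. by move=> [pZ _]; rewrite -(scale0r 0) pZ // mul0r. Qed.

Lemma sublinear_ge_opp p x : sublinear p -> - p (- x) <= p x.
Proof.
move=> ps; have := ps.2 x (- x).
by rewrite subrr (sublinear0 ps); lra.
Qed.

(** Homogeneity follows from the inequality for positive scalars, by applying
    that inequality to the inverse scalar as well. *)
Lemma le_sublinear p : p 0 = 0 ->
    (forall (a : R) x, 0 < a -> p (a *: x) <= a * p x) ->
    (forall x y, p (x + y) <= p x + p y) ->
  sublinear p.
Proof.
move=> p0 pZ pD; split => // a x; rewrite le_eqVlt => /predU1P[<-|a0].
  by rewrite scale0r mul0r.
apply/eqP; rewrite eq_le pZ //= -ler_pdivlMl //.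
have := pZ a^-1 (a *: x); rewrite invr_gt0 scalerA mulVf ?gt_eqF // scale1r.
exact.
Qed.

(** The largest [q] such that [q y <= p (y + d) - s] for all [y] and all [(d, s)]
    in [D]. A linear functional below it is at least [s] at [d] for each such
    pair, because its value at [- d] is at most [p 0 - s]. So this single
    construction serves both to make functionals smaller and to force a
    prescribed behaviour on a cone. *)
Definition cone_relax p D : E -> R :=
  fun y => inf [set p (y + d.1) - d.2 | d in D].

Section Relax.
Context (p : E -> R) (D : set (E * R^o)%type).
Hypotheses (ps : sublinear p) (Dcone : convex_cone D)
  (pD : forall d, D d -> d.2 <= p d.1).

Let D0 : D 0.
Proof. by case: Dcone => -[d Dd] _ DZ; rewrite -(scale0r d); exact: DZ. Qed.

Let relax_lb y d : D d -> - p (- y) <= p (y + d.1) - d.2.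
Proof.
move=> /pD; have := ps.2 (- y) (y + d.1).
by rewrite addKr; lra.
Qed.

Let has_inf_relax y : has_inf [set p (y + d.1) - d.2 | d in D].
Proof.
split; first by exists (p (y + 0) - 0), 0.
by exists (- p (- y)) => _ [d Dd <-]; exact: relax_lb.
Qed.

Lemma cone_relax_le y d : D d -> cone_relax p D y <= p (y + d.1) - d.2.
Proof. by move=> Dd; apply: ge_inf; [case: (has_inf_relax y)|exists d]. Qed.

Lemma cone_relax_ge y r :
  (forall d, D d -> r <= p (y + d.1) - d.2) -> r <= cone_relax p D y.
Proof.
by move=> h; apply: lb_le_inf => [|_ [d Dd <-]]; [case: (has_inf_relax y)|exact: h].
Qed.

Lemma cone_relax_le_self y : cone_relax p D y <= p y.
Proof. by have := cone_relax_le y D0; rewrite /= addr0 subr0. Qed.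

Lemma cone_relax_sublinear : sublinear (cone_relax p D).
Proof.
case: Dcone => _ DD DZ.
have leZ (a : R) x : 0 < a -> cone_relax p D (a *: x) <= a * cone_relax p D x.
  move=> a0; rewrite -ler_pdivrMl //; apply: cone_relax_ge => d Dd.
  rewrite ler_pdivrMl //; have := cone_relax_le (a *: x) (DZ a d (ltW a0) Dd).
  rewrite -[(a *: d).1]/(a *: d.1) -[(a *: d).2]/(a * d.2).
  rewrite -scalerDr (ps.1 _ _ (ltW a0)).
  by rewrite mulrBr.
apply: le_sublinear => // [|x y].
  apply/eqP; rewrite eq_le; apply/andP; split.
    by rewrite -[leRHS](sublinear0 ps) cone_relax_le_self.
  apply: cone_relax_ge => d Dd; have := relax_lb 0 Dd.
  by rewrite oppr0 (sublinear0 ps) oppr0.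
rewrite -lerBlDr; apply: cone_relax_ge => d Dd.
rewrite lerBlDr -lerBlDl; apply: cone_relax_ge => e De.
have := cone_relax_le (x + y) (DD _ _ Dd De).
have := ps.2 (x + d.1) (y + e.1); rewrite addrACA /=.
rewrite -[(d.2 + e.2)%R]/(d.2 + e.2 : R); lra.
Qed.

End Relax.

(** Relaxing [p] along the ray spanned by [(y, p y)] gives a sublinear
    functional below [p], hence [p] itself. This says [p x <= p (x + y) - p y],
    which together with subadditivity is additivity. *)
Lemma sublinear_minimal_linear p : sublinear p ->
    (forall q, sublinear q -> (forall x, q x <= p x) -> q = p) ->
  linear (p : E -> R^o).
Proof.
move=> ps pmin.
have pB x y : p x + p y <= p (x + y).
  pose D := [set (a *: y, a * p y : R^o) | a in [set a : R | 0 <= a]].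
  have Dcone : convex_cone D.
    split; first by exists (0 *: y, 0 * p y), 0 => /=.
      move=> _ _ [a /= a0 <-] [b /= b0 <-]; exists (a + b) => /=.
        exact: addr_ge0.
      by rewrite scalerDl mulrDl.
    move=> a _ a0 [b /= b0 <-]; exists (a * b); first exact: mulr_ge0.
    by rewrite -scalerA -mulrA.
  have pD d : D d -> d.2 <= p d.1 by move=> [a /= a0 <-] /=; rewrite ps.1.
  have Ep : cone_relax p D = p.
    by apply: pmin => [|x']; [exact: cone_relax_sublinear|exact: cone_relax_le_self].
  have Dy : D (y, p y) by exists 1 => //=; rewrite scale1r mul1r.
  by have := cone_relax_le ps Dcone pD x Dy; rewrite Ep /=; lra.
have pD x y : p (x + y) = p x + p y by apply/eqP; rewrite eq_le ps.2 pB.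
have pN x : p (- x) = - p x.
  by have := pD x (- x); rewrite subrr sublinear0 //; lra.
move=> a x y; rewrite pD; congr (_ + _); case: (leP 0 a) => [/ps.1->//|a0].
rewrite -[a]opprK scaleNr pN ps.1 ?oppr_ge0 1?ltW //.
by rewrite -[(- - a) *: p x]/(- - a * p x) mulNr.
Qed.

(** The infimum of a chain of sublinear functionals below [p] is finite, since
    all of them are at least [fun x => - p (- x)], and it is subadditive
    because any two members of the chain are comparable. *)
Lemma sublinear_minimal p : sublinear p ->
  exists2 q, sublinear q /\ (forall x, q x <= p x) &
    forall r, sublinear r -> (forall x, r x <= q x) -> r = q.
Proof.
move=> ps.
pose T := {q | sublinear q /\ forall x, q x <= p x}.
pose below (s t : T) := `[< forall x, sval t x <= sval s x >].
have [||||q qmin] := @Zorn T below.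
- by move=> t; apply/asboolP.
- move=> r s t /asboolP rs /asboolP st; apply/asboolP => x.
  exact: le_trans (rs x).
- move=> [s hs] [t ht] /asboolP/= st /asboolP/= ts.
  apply: eq_exist => /=; apply/funext => x.
  by apply/eqP; rewrite eq_le ts st.
- move=> A Atot; have [[s0 As0]|A0] := pselect (A !=set0); last first.
    exists (exist _ p (conj ps (fun=> lexx _))) => s As.
    by case: A0; exists s.
  pose V x := [set sval s x | s in A].
  have Vlb (s : T) x : - p (- x) <= sval s x.
    case: s => s [ss sp] /=; have := sublinear_ge_opp x ss; have := sp (- x).
    lra.
  have Vinf x : has_inf (V x).
    by split; [exists (sval s0 x), s0|exists (- p (- x)) => _ [s _ <-]].
  have Vle (s : T) x : A s -> inf (V x) <= sval s x.
    by move=> As; apply: ge_inf; [case: (Vinf x)|exists s].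
  have Vge x r : (forall s : T, A s -> r <= sval s x) -> r <= inf (V x).
    by move=> h; apply: lb_le_inf => [|_ [s As <-]]; [case: (Vinf x)|exact: h].
  have leZ (a : R) x : 0 < a -> inf (V (a *: x)) <= a * inf (V x).
    move=> a0; rewrite -ler_pdivrMl //; apply: Vge => s As; rewrite ler_pdivrMl //.
    by rewrite -((svalP s).1.1 _ _ (ltW a0)); exact: Vle.
  have infs : sublinear (fun x => inf (V x)).
    apply: le_sublinear => // [|x y].
      apply/eqP; rewrite eq_le; apply/andP; split.
        by rewrite -(sublinear0 (svalP s0).1) Vle.
      by apply: Vge => s _; rewrite (sublinear0 (svalP s).1).
    rewrite -lerBlDr; apply: (Vge) => s As; rewrite lerBlDr -lerBlDl.
    apply: Vge => t At; rewrite lerBlDl.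
    have [/asboolP st|/asboolP ts] := Atot s t As At.
      by have := Vle t (x + y) At; have := (svalP t).1.2 x y; have := st x; lra.
    by have := Vle s (x + y) As; have := (svalP s).1.2 x y; have := ts y; lra.
  have infp x : inf (V x) <= p x.
    by apply: le_trans (Vle s0 x As0) _; case: (svalP s0).
  exists (exist _ (fun x => inf (V x)) (conj infs infp)) => s As.
  by apply/asboolP => x /=; exact: Vle.
exists (sval q); first exact: (svalP q).
move=> r rs rq.
have rp x : r x <= p x by rewrite (le_trans (rq x)) ?(svalP q).2.
by have <- := qmin (exist _ r (conj rs rp)) (asboolT rq).
Qed.

(** Hahn-Banach theorem in sandwich form: the lower bounds prescribed by the
    cone [D] need only be compatible with [p] on [D] itself. *)
Lemma hahn_banach p D : sublinear p -> convex_cone D ->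
    (forall d, D d -> d.2 <= p d.1) ->
  exists f : {scalar E}, (forall x, f x <= p x) /\ forall d, D d -> d.2 <= f d.1.
Proof.
move=> ps Dcone pD; have qs := cone_relax_sublinear ps Dcone pD.
have [g [gs gq] gmin] := sublinear_minimal qs.
have glin := sublinear_minimal_linear gs gmin.
pose gM := GRing.isLinear.Build R E R^o _ g glin.
pose f : {scalar E} := HB.pack g gM.
exists f; split=> [x|d Dd].
  exact: le_trans (gq x) (cone_relax_le_self ps Dcone pD x).
have := gq (- d.1); have := cone_relax_le ps Dcone pD (- d.1) Dd.
rewrite addNr (sublinear0 ps) -[g (- d.1)]/(f (- d.1)) linearN.
rewrite -[f d.1]/(g d.1) -[(- f d.1)%R]/(- g d.1 : R); lra.
Qed.

End HahnBanach.

(** * Separating a point from a cone *)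

Section Separation.
Context {R : realType}.

(** The conclusions [0 <= f c] and [e <= f (- x)] are the lower bounds [0] at [c]
    and [e] at [- x]; they are imposed through the cone that these pairs
    generate, on which [t * e <= p (c - t *: x)] is the hypothesis rescaled. *)
Lemma cone_separation (E : lmodType R) (p : E -> R) (C : set E) (x : E) (e : R) :
    sublinear p -> (forall y, 0 <= p y) -> convex_cone C -> 0 < e ->
    (forall c, C c -> e <= p (c - x)) ->
  exists f : {scalar E},
    [/\ forall y, f y <= p y, forall c, C c -> 0 <= f c & f x < 0].
Proof.
move=> ps p0 [[c0 Cc0] CD CZ] e0 pC.
pose D := [set d : (E * R^o)%type | exists (c : E) (t : R),
  [/\ C c, 0 <= t & d = (c - t *: x, t * e : R^o)]].
have C0 : C 0 by rewrite -(scale0r c0); exact: CZ.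
have Dcone : convex_cone D.
  split.
  - by exists (0 - 0 *: x, 0 * e : R^o), 0, 0.
  - move=> _ _ [c [t [Cc t0 ->]]] [d [s [Cd s0 ->]]]; exists (c + d), (t + s).
    split; [exact: CD|exact: addr_ge0|].
    by congr pair; rewrite ?mulrDl // scalerDl opprD addrACA.
  - move=> a _ a0 [c [t [Cc t0 ->]]]; exists (a *: c), (a * t).
    split; [exact: CZ|exact: mulr_ge0|].
    by congr pair; rewrite -?mulrA // -scalerA -scalerBr.
have pD d : D d -> d.2 <= p d.1.
  move=> [c [t [Cc t0 ->]]] /=.
  move: t0; rewrite le_eqVlt => /predU1P[<-|t0]; first by rewrite mul0r.
  have -> : c - t *: x = t *: (t^-1 *: c - x).
    by rewrite scalerBr scalerA mulfV ?gt_eqF // scale1r.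
  rewrite (ps.1 _ _ (ltW t0)) ler_pM2l //; apply: pC; apply: CZ => //.
  by rewrite invr_ge0 ltW.
have [f [fp fD]] := hahn_banach ps Dcone pD.
exists f; split => // [c Cc|].
  have := fD (c, 0) => /=; apply; exists c, 0; split => //.
  by rewrite scale0r subr0 mul0r.
have : D (- x, e : R^o) by exists 0, 1; rewrite scale1r mul1r sub0r.
by move/fD => /=; rewrite linearN -[(- f x)%R]/(- f x : R); lra.
Qed.

End Separation.

(** * Continuity of linear functionals *)

Section ContinuousFunctionals.
Context {R : realType} {E : topologicalLmodType R}.

Lemma nbhs_dilation (U : set E) (k : R) (x : E) :
  nbhs 0 U -> \forall y \near x, U (k *: (y - x)).
Proof.
move=> U0.
have := @scale_continuous R E (k, 0) U; rewrite /= scaler0 => /(_ U0).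
move=> [[A B] /= [A1 B1] AB].
have := @sub_continuous E (x, x) B; rewrite /= subrr => /(_ B1).
move=> [[A' B'] /= [A'1 B'1] AB']; apply: filterS A'1 => y A'y.
apply: (AB (k, y - x)); split => /=; first exact: nbhs_singleton.
by apply: (AB' (y, x)); split => //=; exact: nbhs_singleton.
Qed.

(** A one-sided bound suffices: applied to [- y] it bounds [f] from below. *)
Lemma bounded_above_continuous (f : {scalar E}) (M : R) :
  (\forall y \near (0 : E), f y <= M) -> continuous (f : E -> R).
Proof.
move=> fM x; apply/cvgrPdist_le => e e0.
have M'0 : 0 < `|M| + 1 by rewrite ltr_wpDl.
have leM' y : f y <= M -> f y <= `|M| + 1.
  by move=> /le_trans; apply; rewrite (le_trans (ler_norm _)) // lerDl.
pose k := (`|M| + 1) / e.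
have k0 : 0 < k by rewrite divr_gt0.
near=> y.
have h1 : f (k *: (y - x)) <= `|M| + 1.
  by apply: leM'; near: y; exact: nbhs_dilation fM.
have h2 : f (- k *: (y - x)) <= `|M| + 1.
  by apply: leM'; near: y; exact: nbhs_dilation fM.
have fE c : f (c *: (y - x)) = c * (f y - f x) by rewrite linearZ linearB.
move: h1 h2; rewrite !fE => h1 h2.
rewrite distrC -(ler_pM2l k0) -[X in X * _](gtr0_norm k0) -normrM.
rewrite /k mulfVK ?gt_eqF // ler_norml -/k h1 andbT; lra.
Unshelve. all: by end_near. Qed.

(** If [f a != 0], then [f (a + u) != 0] for small [u]. When [f w] is too large,
    the multiple of [w] on which [f] takes the value [- f a] is such a small
    [u]; so [f] is bounded near [0]. *)
Lemma closed_kernel_continuous (f : {scalar E}) :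
  closed [set x | f x = 0] -> continuous (f : E -> R).
Proof.
move=> kerf; have [[a fa]|f0] := pselect (exists a, f a != 0); last first.
  apply: (@bounded_above_continuous f 0); apply: nearW => y.
  by rewrite leNgt; apply/negP => fy; apply: f0; exists y; rewrite gt_eqF.
have Ua : \forall u \near (0 : E), f (a + u) != 0.
  have : nbhs (a + 0) (~` [set x | f x = 0]).
    rewrite addr0; apply: open_nbhs_nbhs; split; last exact/eqP.
    exact: closed_openC.
  have /(_ (a, 0)) := @add_continuous E.
  move=> /[apply] /= -[[A B] /= [A1 B1] AB].
  apply: filterS B1 => u Bu; apply/eqP; apply: (AB (a, u)); split => //=.
  exact: nbhs_singleton.
have := @scale_continuous R E (0, 0) [set u | f (a + u) != 0].
rewrite /= scaler0 => /(_ Ua).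
move=> [[A B] /= [A0 B0] AB].
have [d /= d0 dA] : exists2 d : R, 0 < d & ball (0 : R^o) d `<=` A.
  by move/nbhs_ballP : A0 => [d d0 dA]; exists d.
apply: (@bounded_above_continuous f (`|f a| / d)); apply: filterS B0 => w Bw.
rewrite leNgt; apply/negP => fw.
have fw0 : 0 < f w by apply: le_lt_trans fw; rewrite divr_ge0 // ltW.
suff : f (a + - (f a / f w) *: w) != 0.
  have fE c : f (a + c *: w) = f a + c * f w by rewrite linearD linearZ.
  by rewrite fE mulNr divfK ?(gt_eqF fw0) // subrr eqxx.
apply: (AB (- (f a / f w), w)); split => //=; apply: dA.
rewrite -ball_normE /ball_ /= sub0r opprK normrM normfV.
  by rewrite (gtr0_norm fw0) ltr_pdivrMr // mulrC -ltr_pdivrMr.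
Qed.

End ContinuousFunctionals.

(** * Topologies defined by directed families of seminorms *)

Section Seminorms.
Context {R : realType} {E : lmodType R}.
Implicit Types (p q : E -> R) (S : set (E -> R)).

Definition seminorm p :=
  (forall (a : R) x, p (a *: x) = `|a| * p x) /\
  (forall x y, p (x + y) <= p x + p y).

Lemma seminorm_sublinear p : seminorm p -> sublinear p.
Proof. by move=> [pZ pD]; split => // a x a0; rewrite pZ ger0_norm. Qed.

Lemma seminorm0 p : seminorm p -> p 0 = 0.
Proof. by move=> /seminorm_sublinear/sublinear0. Qed.

Lemma seminormN p x : seminorm p -> p (- x) = p x.
Proof. by move=> [pZ _]; rewrite -scaleN1r pZ normrN1 mul1r. Qed.

Lemma seminormB p x y : seminorm p -> p (x - y) = p (y - x).
Proof. by move=> sp; rewrite -opprB seminormN. Qed.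

Lemma seminorm_ge0 p x : seminorm p -> 0 <= p x.
Proof.
move=> sp; have := sp.2 x (- x).
by rewrite subrr (seminorm0 sp) (seminormN x sp); lra.
Qed.

Lemma seminorm_max p q : seminorm p -> seminorm q ->
  seminorm (fun x => Num.max (p x) (q x)).
Proof.
move=> [pZ pD] [qZ qD]; split=> [a x|x y]; first by rewrite pZ qZ maxr_pMr.
by rewrite ge_max (le_trans (pD _ _)) ?(le_trans (qD _ _)) //
  lerD // le_max lexx ?orbT.
Qed.

Lemma seminorm_abs (f : {scalar E}) : seminorm (fun x => `|f x|).
Proof.
split=> [a x|x y]; first by rewrite linearZ normrM.
by rewrite linearD ler_normD.
Qed.

(** A functional that is monotone for the cone is squeezed between its values
    at the ends of an order interval. This is what makes the topologies built
    from positive functionals normal. *)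
Lemma abs_order_interval (C : set E) (f : {scalar E}) x y z :
    (forall c, C c -> 0 <= f c) -> cone_le C x y -> cone_le C y z ->
  `|f y| <= Num.max `|f x| `|f z|.
Proof.
move=> fC /fC + /fC; rewrite !linearB !subr_ge0 => fxy fyz; rewrite le_max.
have [y0|y0] := leP 0 (f y).
  by apply/orP; right; rewrite !ger0_norm // (le_trans y0).
by apply/orP; left; rewrite !ler0_norm ?lerN2 // ?(le_trans fxy) // ltW.
Qed.

Definition seminorm_ball p x (e : R) := [set y | p (y - x) < e].

Definition directed_seminorms S :=
  [/\ S !=set0, forall p, S p -> seminorm p &
      forall p q, S p -> S q -> exists r,
        [/\ S r, forall x, p x <= r x & forall x, q x <= r x]].

Definition seminorm_open S : set_system E :=
  [set A | forall x, A x -> exists p e,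
    [/\ S p, 0 < e & seminorm_ball p x e `<=` A]].

End Seminorms.

Section SeminormTopology.
Context {R : realType} {E : lmodType R} (S : set (E -> R)).
Hypothesis Sdir : directed_seminorms S.

Let Ssemi p : S p -> seminorm p. Proof. by case: Sdir => _ + _; apply. Qed.

Let seminorm_openT : seminorm_open S setT.
Proof. by case: Sdir => -[p Sp] _ _ x _; exists p, 1. Qed.

Let seminorm_openI : setI_closed (seminorm_open S).
Proof.
move=> A B Ao Bo x [/Ao[p [e [Sp e0 pA]]] /Bo[q [d [Sq d0 qB]]]].
case: Sdir => _ _ /(_ p q Sp Sq)[r [Sr pr qr]].
exists r, (Num.min e d); split => //; first by rewrite lt_min e0.
move=> y; rewrite /seminorm_ball /= lt_min => /andP[re rd].
by split; [apply: pA; exact: le_lt_trans re|apply: qB; exact: le_lt_trans rd].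
Qed.

Let seminorm_open_bigcup (I : Type) (f : I -> set E) :
  (forall i, seminorm_open S (f i)) -> seminorm_open S (\bigcup_i f i).
Proof.
move=> fo x [i _ /fo[p [e [Sp e0 pf]]]]; exists p, e; split => // y /pf fiy.
by exists i.
Qed.

Definition seminorm_topology : topology_on E :=
  TopologyOn seminorm_openT seminorm_openI seminorm_open_bigcup.

Local Notation F := (retopologized seminorm_topology).

Lemma seminorm_ball_open p x e : S p -> open (seminorm_ball p x e : set F).
Proof.
move=> Sp; suff : seminorm_open S (seminorm_ball p x e) by [].
move=> y; rewrite /seminorm_ball /= => pxy; exists p, (e - p (y - x)).
split => //; first by rewrite subr_gt0.
move=> z; rewrite /seminorm_ball /=; have := (Ssemi Sp).2 (z - y) (y - x).
by rewrite addrA subrK; lra.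
Qed.

Lemma seminorm_ball_center p x e : S p -> 0 < e -> seminorm_ball p x e x.
Proof. by move=> Sp e0; rewrite /seminorm_ball /= subrr (seminorm0 (Ssemi Sp)). Qed.

Lemma nbhs_seminorm_ball p x e : S p -> 0 < e ->
  nbhs (x : F) (seminorm_ball p x e).
Proof.
move=> Sp e0; apply: open_nbhs_nbhs; split; first exact: seminorm_ball_open.
exact: seminorm_ball_center.
Qed.

Lemma nbhs_seminormP (x : F) (U : set F) : nbhs x U <->
  exists p e, [/\ S p, 0 < e & seminorm_ball p x e `<=` U].
Proof.
split=> [|[p [e [Sp e0 /filterS]]]]; last by apply; exact: nbhs_seminorm_ball.
rewrite nbhsE => -[A [Ao Ax] AU]; 
have [p [e [Sp e0 pA]]] := (Ao : seminorm_open S A) x Ax.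
by exists p, e; split => //; exact: subset_trans AU.
Qed.

Lemma seminorm_add_continuous : continuous (fun z : F * F => z.1 + z.2).
Proof.
move=> [x y] U /nbhs_seminormP[p [e [Sp e0 pU]]].
exists (seminorm_ball p x (e / 2), seminorm_ball p y (e / 2)).
  by split; apply: nbhs_seminorm_ball; rewrite // divr_gt0.
move=> [u v] [/= pu pv]; apply: pU; move: pu pv; rewrite /seminorm_ball /=.
rewrite opprD addrACA; have := (Ssemi Sp).2 (u - x) (v - y); lra.
Qed.

Lemma seminorm_scale_continuous : continuous (fun z : R^o * F => z.1 *: z.2).
Proof.
move=> [a x] U /nbhs_seminormP[p [e [Sp e0 pU]]].
have px0 := seminorm_ge0 x (Ssemi Sp).
have M0 : 0 < p x + 1 by rewrite ltr_wpDl.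
have N0 : 0 < `|a| + 1 by rewrite ltr_wpDl.
pose d := Num.min 1 (e / 2 / (p x + 1)).
exists (ball a d, seminorm_ball p x (e / 2 / (`|a| + 1))).
  split; last by apply: nbhs_seminorm_ball; rewrite // !divr_gt0.
  by apply: nbhsx_ballx; rewrite lt_min ltr01 !divr_gt0.
move=> [b y] [/=]; rewrite -ball_normE /ball_ /= lt_min => /andP[ab1 abx] pyx.
apply: pU; rewrite /seminorm_ball /=.
have -> : b *: y - a *: x = b *: (y - x) + (b - a) *: x.
  by rewrite scalerBr scalerBl addrA subrK.
apply: le_lt_trans ((Ssemi Sp).2 _ _) _; rewrite !(Ssemi Sp).1.
have lb : `|b| <= `|a| + 1.
  have := ler_normD (b - a) a; rewrite subrK distrC; lra.
have := seminorm_ge0 (y - x) (Ssemi Sp).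
move: abx pyx; rewrite distrC /seminorm_ball /= !ltr_pdivlMr // => h1 h2 h3.
have := ler_wpM2r h3 lb; have : 0 <= `|b - a| by [].
rewrite mulrDr in h1; lra.
Qed.

Lemma seminorm_ball_convex p x e : seminorm p ->
  @convex_set R E (seminorm_ball p x e).
Proof.
move=> sp; apply/convex_setW => y z; rewrite !inE /seminorm_ball /= => py pz k k0 k1.
rewrite inE /=.
set t := (k%:num) in k0 k1.
have -> : conv k (y : convex_lmodType E) z - x = t *: (y - x) + (1 - t) *: (z - x).
  rewrite !scalerBr addrACA -opprD -scalerDl addrCA subrr addr0 scale1r.
  by [].
apply: le_lt_trans (sp.2 _ _) _; rewrite !sp.1 !ger0_norm ?subr_ge0 ?ltW //.
have h1 : t * p (y - x) < t * e by rewrite ltr_pM2l.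
have h2 : (1 - t) * p (z - x) < (1 - t) * e by rewrite ltr_pM2l // subr_gt0.
have -> : e = t * e + (1 - t) * e by ring.
exact: ltrD.
Qed.

Lemma seminorm_hausdorff :
  (forall x, x != 0 -> exists2 p, S p & p x != 0) -> hausdorff_space F.
Proof.
move=> Ssep x y xy; apply/eqP; rewrite -subr_eq0; apply/negPn/negP.
move=> /Ssep[p Sp pxy].
have pxy0 : 0 < p (x - y) by rewrite lt_def pxy seminorm_ge0 //; exact: Ssemi.
have e0 : 0 < p (x - y) / 2 by rewrite divr_gt0.
have [z []] := xy _ _ (nbhs_seminorm_ball x Sp e0) (nbhs_seminorm_ball y Sp e0).
rewrite /seminorm_ball /= (seminormB z x (Ssemi Sp)).
have := (Ssemi Sp).2 (x - z) (z - y); rewrite addrA subrK; lra.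
Qed.

Lemma seminorm_locally_convex :
  (forall x, x != 0 -> exists2 p, S p & p x != 0) -> locally_convex_space F.
Proof.
move=> Ssep; split.
- exact: seminorm_add_continuous.
- exact: seminorm_scale_continuous.
- exists [set B | exists p x e, S p /\ B = seminorm_ball p x e].
    move=> b; rewrite inE => -[p [x [e [Sp ->]]]].
    exact: seminorm_ball_convex (Ssemi Sp).
  split=> [b [p [x [e [Sp ->]]]]|x U]; first exact: seminorm_ball_open.
  move=> /nbhs_seminormP[p [e [Sp e0 pU]]].
  exists (seminorm_ball p x e) => //; split; first by exists p, x, e.
  exact: seminorm_ball_center.
- exact: seminorm_hausdorff.
Qed.

Lemma seminorm_normal_cone (C : set E) :
  (forall p x y z, S p -> cone_le C x y -> cone_le C y z ->
     p y <= Num.max (p x) (p z)) ->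
  normal_cone (C : set F).
Proof.
move=> Sfull V /nbhs_seminormP[p [e [Sp e0 pV]]].
exists (seminorm_ball p 0 e); split => //; first exact: nbhs_seminorm_ball.
move=> x y z xy yz; rewrite /seminorm_ball /= !subr0 => px pz.
by rewrite (le_lt_trans (Sfull p x y z Sp xy yz)) // gt_max px.
Qed.

End SeminormTopology.

Lemma seminorm_topology_coarser (R : realType) (E : topologicalLmodType R)
    (S : set (E -> R)) (Sdir : directed_seminorms S) :
  (forall p e, S p -> 0 < e -> nbhs (0 : E) [set x | p x < e]) ->
  coarser_than (seminorm_topology Sdir).
Proof.
move=> Scts A Ao; rewrite openE => x /Ao[p [e [Sp e0 pA]]].
apply: filterS pA _; have := nbhs_dilation 1 x (Scts p e Sp e0).
by apply: filterS => y; rewrite scale1r.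
Qed.

(** * The weak closure of a cone *)

Section WeakTopology.
Context {R : realType} {E : topologicalLmodType R}.
Implicit Types (C : set E) (x : E) (f : {scalar E}).

Lemma weak_cvgP (F : set_system E) x : Filter F ->
  F --> (x : weakly E) <-> forall f, top_dual f -> (f : E -> R) @ F --> f x.
Proof.
move=> FF; split=> [Fx f fcts|Fx].
  have /cvg_sup/(_ (exist _ f fcts)) Fxf := Fx.
  by move=> U fU; apply: Fxf; exact: (@initial_continuous _ _ (f : E -> R) x U fU).
apply/cvg_sup => -[f fcts] U /= [_ [[V Vo <-] Vx] VU].
by apply: filterS VU _; apply: (Fx f fcts); exact: open_nbhs_nbhs.
Qed.

Lemma weak_closureP C x : weak_closure C x <->
  exists F : set_system E, [/\ ProperFilter F, F C &
    forall f, top_dual f -> (f : E -> R) @ F --> f x].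
Proof.
rewrite /weak_closure closureEcvg; split=> [[F FF [Fx CF]]|[F [FF FC Fx]]].
  by exists F; split => //; [by apply: CF|exact/weak_cvgP].
exists F => //; split; first exact/weak_cvgP.
by move=> A CA; apply: filterS FC.
Qed.

Lemma subset_weak_closure C : C `<=` weak_closure C.
Proof. exact: (@subset_closure (weakly E) C). Qed.

Lemma weak_closure_convex_cone C : convex_cone C -> convex_cone (weak_closure C).
Proof.
move=> [[c0 Cc0] CD CZ]; split.
- by exists c0; exact: subset_weak_closure.
- move=> x y /weak_closureP[F [FF FC Fx]] /weak_closureP[G [GG GC Gy]].
  apply/weak_closureP; exists ((fun z : E * E => z.1 + z.2) @ (F, G)); split.
  + exact: fmap_proper_filter.
  + by exists (C, C) => // -[u v] [/= Cu Cv]; exact: CD.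
  + move=> f fcts; rewrite linearD.
    have Fx1 : (fun z : E * E => f z.1) @ (F, G) --> f x.
      exact: cvg_comp _ _ cvg_fst (Fx f fcts).
    have Gy2 : (fun z : E * E => f z.2) @ (F, G) --> f y.
      exact: cvg_comp _ _ cvg_snd (Gy f fcts).
    have fD : (f : E -> R) \o (fun z : E * E => z.1 + z.2) =
        (fun z : E * E => f z.1 + f z.2).
      by apply/funext => z /=; rewrite linearD.
    rewrite -fmap_comp fD.
    exact: cvgD Fx1 Gy2.
- move=> a x a0 /weak_closureP[F [FF FC Fx]].
  apply/weak_closureP; exists ((fun z : E => a *: z) @ F); split.
  + exact: fmap_proper_filter.
  + suff : F [set z | C (a *: z)] by [].
    by apply: filterS FC => c; exact: CZ.
  + move=> f fcts; rewrite linearZ.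
    have fZ : (f : E -> R) \o (fun z : E => a *: z) = (fun z : E => a * f z).
      by apply/funext => z /=; rewrite linearZ.
    rewrite -fmap_comp fZ.
    exact: cvgM (cvg_cst a) (Fx f fcts).
Qed.

Lemma weak_closure_ge0 C f x : top_dual_cone C f -> weak_closure C x -> 0 <= f x.
Proof.
move=> [fcts fC] /weak_closureP[F [FF FC /(_ f fcts) Fx]].
apply: (cvgr_to_ge Fx).
by apply: filterS FC.
Qed.

Definition continuous_seminorms : set (E -> R) :=
  [set p | seminorm p /\ forall e, 0 < e -> \forall y \near (0 : E), p y < e].

Lemma continuous_seminorms_max p q :
    continuous_seminorms p -> continuous_seminorms q ->
  continuous_seminorms (fun x => Num.max (p x) (q x)).
Proof.
move=> [sp pc] [sq qc]; split=> [|e e0]; first exact: seminorm_max.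
by near=> y; rewrite gt_max; apply/andP; split; near: y; [exact: pc|exact: qc].
Unshelve. all: by end_near. Qed.

Lemma continuous_seminorms_directed : directed_seminorms continuous_seminorms.
Proof.
split=> [|p []//|p q pc qc].
  exists (fun=> 0); split; last by move=> e e0; exact: nearW.
  by split=> *; rewrite ?mulr0 ?addr0.
exists (fun x => Num.max (p x) (q x)); split.
- exact: continuous_seminorms_max.
- by move=> x; rewrite le_max lexx.
- by move=> x; rewrite le_max lexx orbT.
Qed.

Lemma continuous_seminorm_abs f : top_dual f ->
  continuous_seminorms (fun x => `|f x|).
Proof.
move=> fcts; split=> [|e e0]; first exact: seminorm_abs.
have := fcts 0; rewrite /continuous_at linear0 => /cvgrPdist_lt /(_ e e0).
by apply: filterS => y; rewrite sub0r normrN.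
Qed.

(** The topology given by all continuous seminorms is finer than the weak one,
    since it has every [fun x => `|f x|] among its seminorms. Using it instead
    of the weak topology avoids finite families of functionals, and its
    seminorms are continuous, which is all that a separation argument needs. *)
Lemma notin_weak_closure C x : ~ weak_closure C x ->
  exists p e, [/\ continuous_seminorms p, 0 < e & forall c, C c -> e <= p (c - x)].
Proof.
move=> nCx; set S := continuous_seminorms.
have Sdir : directed_seminorms S := continuous_seminorms_directed.
pose F := retopologized (seminorm_topology Sdir).
have weaker : nbhs (x : F) --> (x : weakly E).
  apply/weak_cvgP => f fcts; apply/cvgrPdist_lt => e e0.
  have := @nbhs_seminorm_ball _ _ _ Sdir _ x e (continuous_seminorm_abs fcts) e0.
  have -> : seminorm_ball (fun y => `|f y|) x e = [set y | `|f x - f y| < e].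
    by apply/seteqP; split => y; rewrite /seminorm_ball /= linearB distrC.
  by [].
have : nbhs (x : F) (~` C).
  apply: weaker; suff : interior (~` C : set (weakly E)) x by [].
  by rewrite interiorC.
move=> /nbhs_seminormP[p [e [Sp e0 pC]]]; exists p, e; split => // c Cc.
by rewrite leNgt; apply/negP => /pC.
Qed.

(** If [x != 0], then [x] or [- x] is outside the proper cone that is the weak
    closure, and a point outside is separated from the cone. *)
Lemma proper_weak_closure_separates C : convex_cone C ->
  proper_cone (weak_closure C) -> separates_points (top_dual_cone C).
Proof.
move=> Ccone [Kcone Kproper] x x0.
have sep y : ~ weak_closure C y -> exists2 f, top_dual_cone C f & f y != 0.
  move=> /notin_weak_closure[p [e [[sp pc] e0 pC]]].
  have [f [fp fC fy]] := cone_separation (seminorm_sublinear sp)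
    (fun y => seminorm_ge0 y sp) Ccone e0 pC.
  exists f; last by rewrite lt_eqF.
  split => //; apply: (@bounded_above_continuous _ _ _ 1).
  by apply: filterS (pc 1 ltr01) => z /ltW; apply: le_trans.
have [Kx|/sep//] := pselect (weak_closure C x).
have [f fC fx] : exists2 f, top_dual_cone C f & f (- x) != 0.
  apply: sep => Kx'; have : (weak_closure C `&` [set - y | y in weak_closure C]) x.
    by split => //; exists (- x) => //; rewrite opprK.
  by rewrite Kproper => /eqP; apply/negP.
by exists f => //; move: fx; rewrite linearN oppr_eq0.
Qed.

Lemma separates_proper_weak_closure C : convex_cone C ->
    separates_points (top_dual_cone C) ->
  separates_points (@top_dual R E) /\ proper_cone (weak_closure C).
Proof.
move=> Ccone sepC; split=> [x /sepC[f [fcts _] fx]|]; first by exists f.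
split; first exact: weak_closure_convex_cone.
have Kcone := weak_closure_convex_cone Ccone.
apply/seteqP; split=> [x [Kx [y Ky yx]]|_ ->]; last first.
  have K0 : weak_closure C 0.
    by case: Kcone => -[c Kc] _ KZ; rewrite -(scale0r c); exact: KZ.
  by split => //; exists 0; rewrite // oppr0.
apply/eqP/negPn/negP => /sepC[f fC]; apply/negP; rewrite negbK.
rewrite eq_le (weak_closure_ge0 fC Kx) andbT -yx linearN oppr_le0.
exact: weak_closure_ge0 fC Ky.
Qed.

(** The seminorms [p] with [p y <= max (p x) (p z)] whenever [x <= y <= z] have
    full balls, are stable under maxima, and contain [fun x => `|f x|] for
    each [f] in the dual cone. *)
Lemma normal_topology C : separates_points (top_dual_cone C) ->
  exists tau : topology_on E,
    [/\ coarser_than tau, locally_convex_space (retopologized tau) &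
        normal_cone (C : set (retopologized tau))].
Proof.
move=> Csep.
pose S := [set p : E -> R | continuous_seminorms p /\ forall x y z,
  cone_le C x y -> cone_le C y z -> p y <= Num.max (p x) (p z)].
have Sabs f : top_dual_cone C f -> S (fun x => `|f x|).
  move=> [fcts fC]; split=> [|x y z]; first exact: continuous_seminorm_abs.
  exact: abs_order_interval.
have Sdir : directed_seminorms S.
  split=> [|p [[]]//|p q [pc pC] [qc qC]].
    exists (fun x => `|(\0 : {scalar E}) x|); apply: Sabs; split=> // x.
    exact: cvg_cst.
  exists (fun x => Num.max (p x) (q x)).
  split; [split|by move=> x; rewrite le_max lexx|by move=> x; rewrite le_max lexx orbT].
    exact: continuous_seminorms_max.
  move=> x y z xy yz; rewrite ge_max.
  by rewrite (le_trans (pC _ _ _ xy yz)) ?(le_trans (qC _ _ _ xy yz)) //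
    ge_max !le_max !lexx ?orbT.
exists (seminorm_topology Sdir); split.
- by apply: seminorm_topology_coarser => p e [[_ pc] _] e0; exact: pc.
- apply: seminorm_locally_convex => x /Csep[f /Sabs Sf fx].
  by exists (fun x => `|f x|) => //; rewrite normr_eq0.
- by apply: seminorm_normal_cone => p x y z [_ pC]; exact: pC.
Qed.

End WeakTopology.

(** * Closed supporting hyperplanes *)

Section Hyperplanes.
Context {R : realType} {E : topologicalLmodType R}.
Implicit Types (C : set E).

(** Since [f] is unbounded below on a cone as soon as it takes a negative value
    there, a hyperplane supporting a cone passes through [0]. *)
Lemma supporting_hyperplane_kernel C (f : {scalar E}) (a : R) : convex_cone C ->
    C `<=` [set x | a <= f x] -> C `&` [set x | f x = a] !=set0 ->
  a = 0 /\ forall c, C c -> 0 <= f c.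
Proof.
move=> [[c0 Cc0] CD CZ] Ca [c [Cc /= fc]].
have C0 : C 0 by rewrite -(scale0r c0); exact: CZ.
have a_le0 : a <= 0 by have := Ca _ C0; rewrite /= linear0.
have a_ge0 : 0 <= a by have := Ca _ (CD _ _ Cc Cc); rewrite /= linearD fc; lra.
have a0 : a = 0 by apply/eqP; rewrite eq_le a_le0.
by split => // d /Ca /=; rewrite a0.
Qed.

Lemma separates_bigcap_hyperplanes C : convex_cone C ->
    separates_points (top_dual_cone C) ->
  \bigcap_(H in [set H : set E | supporting_hyperplane C H /\ closed H]) H = [set 0].
Proof.
move=> Ccone Csep; apply/seteqP; split=> [x Hx|_ -> H [[f [a [_ -> Ca CH]]] _] /=].
  apply/eqP/negPn/negP => /Csep[f [fcts fC] fx].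
  have /eqP := fx; apply; apply: (Hx [set x | f x = 0]); split.
    exists f, 0; split => //; first by exists x.
    have [[c Cc] _ CZ] := Ccone; exists (0 *: c).
    by rewrite scale0r /= linear0; split=> //; rewrite -(scale0r c); exact: CZ.
  apply: (@closed_comp _ _ (f : E -> R) [set 0]); last exact: closed_eq.
  by move=> z _; exact: fcts.
by have [-> _] := supporting_hyperplane_kernel Ccone Ca CH; rewrite linear0.
Qed.

Lemma bigcap_hyperplanes_separates C : convex_cone C ->
  \bigcap_(H in [set H : set E | supporting_hyperplane C H /\ closed H]) H
    = [set 0] ->
  separates_points (top_dual_cone C).
Proof.
move=> Ccone H0 x x0.
have : ~ (\bigcap_(H in [set H : set E | supporting_hyperplane C H /\ closed H]) H) x.
  by rewrite H0 /=; apply/eqP.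
move=> /existsNP[H /not_implyP[[[f [a [_ -> Ca CH]]] Hcl] fx]].
have [a0 fC] := supporting_hyperplane_kernel Ccone Ca CH.
move: Hcl fx; rewrite a0 /= => Hcl /eqP fx; exists f => //; split => //.
exact: closed_kernel_continuous.
Qed.

End Hyperplanes.

(** * Gauges and normal cones *)

Section Gauge.
Context {R : realType} {E : lmodType R} (W : set E).

Definition gauge (x : E) : R := inf [set t : R | 0 < t /\ W (t^-1 *: x)].

Hypotheses (Wconvex : @convex_set R E W) (W0 : W 0)
  (Wabsorbing : forall x, exists2 t : R, 0 < t & W (t *: x)).

Let Wconv x y (t : R) : W x -> W y -> 0 <= t -> t <= 1 -> W (t *: x + (1 - t) *: y).
Proof.
move=> Wx Wy t0 t1.
have := Wconvex (Itv01 t0 t1) (mem_set Wx) (mem_set Wy).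
by rewrite inE.
Qed.

Let gauge_has_inf x : has_inf [set t : R | 0 < t /\ W (t^-1 *: x)].
Proof.
split; last by exists 0 => t [/ltW].
by have [t t0 Wt] := Wabsorbing x; exists t^-1; rewrite /= invr_gt0 invrK.
Qed.

Let gauge_le x t : 0 < t -> W (t^-1 *: x) -> gauge x <= t.
Proof. by move=> t0 Wt; apply: ge_inf; [case: (gauge_has_inf x)|]. Qed.

Let gauge_ge x r : (forall t, 0 < t -> W (t^-1 *: x) -> r <= t) -> r <= gauge x.
Proof.
by move=> h; apply: lb_le_inf => [|t [t0]]; [case: (gauge_has_inf x)|exact: h].
Qed.

Lemma gauge_ge0 x : 0 <= gauge x.
Proof. by apply: gauge_ge => t /ltW. Qed.

Lemma gauge_le1 x : W x -> gauge x <= 1.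
Proof. by move=> Wx; apply: gauge_le; rewrite // invr1 scale1r. Qed.

Lemma gauge_lt1 x : gauge x < 1 -> W x.
Proof.
move=> x1; have [] := inf_lt _ x1; first by case: (gauge_has_inf x).
move=> t [t0 Wt] t1.
have := Wconv Wt W0 (ltW t0) (ltW t1).
by rewrite scalerA mulfV ?gt_eqF // scale1r scaler0 addr0.
Qed.

Lemma gauge_sublinear : sublinear gauge.
Proof.
have leZ (a : R) x : 0 < a -> gauge (a *: x) <= a * gauge x.
  move=> a0; rewrite -ler_pdivrMl //; apply: gauge_ge => t t0 Wt.
  rewrite ler_pdivrMl //; apply: gauge_le; first exact: mulr_gt0.
  by rewrite invfM scalerA mulrAC mulVf ?gt_eqF // mul1r.
have g0 : gauge 0 <= 0.
  apply/ler_addgt0Pl => e e0; rewrite addr0; apply: gauge_le => //.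
  by rewrite scaler0.
apply: le_sublinear => // [|x y].
  by apply/eqP; rewrite eq_le g0 gauge_ge0.
rewrite -lerBlDr; apply: (gauge_ge) => t t0 Wt; rewrite lerBlDr -lerBlDl.
apply: gauge_ge => s s0 Ws; rewrite lerBlDl.
have ts0 : 0 < t + s by exact: addr_gt0.
apply: gauge_le => //.
have t01 : 0 <= t / (t + s) by rewrite divr_ge0 // ltW.
have t1 : t / (t + s) <= 1 by rewrite ler_pdivrMr // mul1r lerDl ltW.
have := Wconv Wt Ws t01 t1.
rewrite !scalerA scalerDr.
have -> : t / (t + s) * t^-1 = (t + s)^-1 by field; rewrite !gt_eqF.
suff -> : (1 - t / (t + s)) * s^-1 = (t + s)^-1 by [].
by field; rewrite !gt_eqF.
Qed.

End Gauge.

Section NormalCones.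
Context {R : realType}.

(** Otherwise there are cone elements [c] near [x] and [d] near [- x]. Then
    [c + d] is near [0] and [0 <= c <= c + d], so [c] is near [0] by normality.
    Hence so is [x = c - (c - x)], contrary to the Hausdorff property. *)
Lemma normal_cone_gap (F : preTopologicalLmodType R) (C : set F) (x : F) :
    locally_convex_space F -> convex_cone C -> normal_cone C -> x != 0 ->
  exists W : set F, [/\ nbhs (0 : F) W, @convex_set R F W &
    (forall c, C c -> ~ W (c - x)) \/ (forall c, C c -> ~ W (c + x))].
Proof.
move=> [Fadd Fscale [B Bconv [Bopen Bnbhs]] FH] [[c0 Cc0] CD CZ] Cnormal x0.
have C0 : C 0 by rewrite -(scale0r c0); exact: CZ.
have addU (U : set F) : nbhs 0 U ->
    exists2 V : set F, nbhs 0 V & forall u v, V u -> V v -> U (u + v).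
  move=> U0; have := Fadd (0, 0) U; rewrite /= addr0 => /(_ U0).
  move=> [[A A'] /= [A0 A'0] AA']; exists (A `&` A'); first exact: filterI.
  by move=> u v [Au _] [_ A'v]; exact: (AA' (u, v)).
have oppU (U : set F) : nbhs 0 U -> nbhs 0 [set u | U (- u)].
  move=> /(nbhs0N_subproof Fscale); apply: filterS => _ [u Uu <-].
  by rewrite /= opprK.
have [V V0 Vx] : exists2 V : set F, nbhs 0 V & ~ V x.
  apply/not_exists2P => V_all; move/eqP: x0; apply; apply: FH => A B' Ax B'0.
  exists x; split; first exact: nbhs_singleton.
  by have [|/contrapT] := V_all B'.
have [V1 V10 V1V] := addU V V0.
have [U [U0 Ufull UV1]] := Cnormal V1 V10.
have [U1 U10 U1U] := addU U U0.
have : nbhs 0 (U1 `&` [set u | V1 (- u)]) by apply: filterI => //; exact: oppU.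
move=> /Bnbhs[W [BW W0] WU].
exists W; split.
- by apply: open_nbhs_nbhs; split => //; exact: Bopen.
- by apply: Bconv; rewrite inE.
apply: contrapT => /not_orP[/existsNP[c /not_implyP[Cc /contrapT Wc]]].
move=> /existsNP[d /not_implyP[Cd /contrapT Wd]]; apply: Vx.
have Ucd : U (c + d).
  have := U1U _ _ (WU _ Wc).1 (WU _ Wd).1.
  by rewrite addrACA addNr addr0.
have Uc : U c.
  apply: (Ufull 0 c (c + d)) => //; first by rewrite /cone_le subr0.
    by rewrite /cone_le addrAC subrr add0r.
  exact: nbhs_singleton U0.
have := V1V _ _ (UV1 _ Uc) (WU _ Wc).2.
by rewrite opprB addrC subrK.
Qed.

(** The gauge of the convex neighbourhood [W] is at least [1] on [c - x] for all
    [c] in the cone. A functional below it is bounded by [1] on [W], which is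
    also a neighbourhood of [0] for the given, finer topology. *)
Lemma normal_cone_separates (E : topologicalLmodType R) (C : set E)
    (tau : topology_on E) : convex_cone C -> coarser_than tau ->
    locally_convex_space (retopologized tau) ->
    normal_cone (C : set (retopologized tau)) ->
  separates_points (top_dual_cone C).
Proof.
move=> Ccone tauE LC Cnormal.
have sep (W : set E) (x : E) : nbhs (0 : E) W -> @convex_set R E W ->
    (forall c, C c -> ~ W (c - x)) -> exists2 f, top_dual_cone C f & f x != 0.
  move=> W0 Wconv WC.
  have Wabs y : exists2 t : R, 0 < t & W (t *: y).
    have := @scale_continuous R E (0, y) W; rewrite /= scale0r => /(_ W0).
    move=> [[A B] /= [/nbhs_ballP[d /= d0 dA] By] AB].
    exists (d / 2); first by rewrite divr_gt0.
    apply: (AB (d / 2, y)); split => /=; last exact: nbhs_singleton.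
    apply: dA; rewrite -ball_normE /ball_ /= sub0r normrN gtr0_norm ?divr_gt0 //.
    by rewrite ltr_pdivrMr // ltr_pMr // ltr1n.
  have W00 : W 0 := nbhs_singleton W0.
  have gC c : C c -> 1 <= gauge W (c - x).
    move=> Cc; rewrite leNgt; apply/negP => /(gauge_lt1 Wconv W00 Wabs).
    exact: WC.
  have [f [fg fC fx]] := cone_separation (gauge_sublinear Wconv W00 Wabs)
    (gauge_ge0 Wabs) Ccone ltr01 gC.
  exists f; last by rewrite lt_eqF.
  split => //; apply: (@bounded_above_continuous _ _ _ 1).
  by apply: filterS W0 => y /(gauge_le1 Wabs); exact: le_trans.
have coarse_nbhs (W : set E) : nbhs (0 : retopologized tau) W -> nbhs (0 : E) W.
  rewrite nbhsE => -[A [/tauE Ao A0] AW].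
  by apply: filterS AW _; exact: open_nbhs_nbhs.
move=> x x0.
have [W [/coarse_nbhs W0 Wconv [WC|WC]]] := normal_cone_gap LC Ccone Cnormal x0.
  exact: sep WC.
have [f fC fx] : exists2 f, top_dual_cone C f & f (- x) != 0.
  by apply: (sep W) => // c Cc; rewrite opprK; exact: WC.
by exists f => //; move: fx; rewrite linearN oppr_eq0.
Qed.

End NormalCones.

(** * Representations by continuous functions *)

Section Evaluation.
Context {R : realType} {Omega : topologicalType}.

Lemma Cp_eval_continuous (w : Omega) :
  continuous (fun g : Cp R Omega => (g : continuousType Omega R) w).
Proof.
move=> g.
pose i (f : continuousType Omega R) : Omega -> R := f.
have ig : {ptws, i @ nbhs (g : Cp R Omega) --> i g}.
  exact: (@initial_continuous _ _ (i : _ -> {ptws Omega -> R}) g).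
exact: (pointwise_cvgP _ _).1 ig w.
Qed.

Lemma Ck_Cp_continuous : continuous (id : Ck R Omega -> Cp R Omega).
Proof.
apply: continuous_comp_initial => g.
pose i (f : continuousType Omega R) : Omega -> R := f.
have ig : {family compact, i @ nbhs (g : Ck R Omega) --> i g}.
  exact: (@initial_continuous _ _ (i : _ -> {family compact, Omega -> R}) g).
exact: pointwise_cvg_compact_family ig.
Qed.

Lemma Ck_continuous_on_compacts (X : topologicalType) (T : X -> Ck R Omega) :
  (forall x K e, compact K -> 0 < e -> \forall y \near x,
     forall w, K w -> `|(T x : continuousType Omega R) w -
                        (T y : continuousType Omega R) w| < e) ->
  continuous T.
Proof.
move=> Tunif; apply: continuous_comp_initial => x.
apply/fam_cvgP => K cK U /uniform_nbhs[V [entV VU]].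
move: entV; rewrite -entourage_ballE => -[e /= e0 eV].
have := Tunif x K e cK e0; apply: filterS => y Kxy.
by apply: VU => w Kw; apply: eV; rewrite /= -ball_normE /=; exact: Kxy.
Qed.

End Evaluation.

Section Representations.
Context {R : realType} {E : topologicalLmodType R} (C : set E).
Implicit Types (Omega : topologicalType).

Lemma Ck_representation_Cp Omega (T : {linear E -> Ck R Omega}) :
    injective_positive_representation T C (@nonneg_functions R Omega) ->
  exists T' : {linear E -> Cp R Omega},
    injective_positive_representation T' C (@nonneg_functions R Omega).
Proof.
move=> [Tc Tinj Tpos].
pose T'M := GRing.isLinear.Build R E (Cp R Omega) _
  (T : E -> Cp R Omega) (linearP T).
pose T' : {linear E -> Cp R Omega} := HB.pack (T : E -> Cp R Omega) T'M.
exists T'; split => //.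
move=> x; apply: (@continuous_comp _ _ _ (T : E -> Ck R Omega)
  (id : Ck R Omega -> Cp R Omega)); [exact: Tc|exact: Ck_Cp_continuous].
Qed.

Lemma Cp_representation_separates Omega (T : {linear E -> Cp R Omega}) :
    injective_positive_representation T C (@nonneg_functions R Omega) ->
  separates_points (top_dual_cone C).
Proof.
move=> [Tc Tinj Tpos] x x0.
have [w Txw] : exists w, (T x : continuousType Omega R) w != 0.
  apply/not_existsP => Tx0; move/eqP: x0; apply; apply: Tinj; rewrite linear0.
  by apply/continuousEP => w; apply/eqP/negPn/negP; exact: Tx0.
pose f0 (y : E) : R^o := (T y : continuousType Omega R) w.
have f0lin : linear f0 by move=> a y z; rewrite /f0 linearP.
pose f0M := GRing.isLinear.Build R E R^o _ f0 f0lin.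
pose f : {scalar E} := HB.pack f0 f0M.
exists f => //; split=> [y|c Cc].
  apply: (@continuous_comp _ _ _ T
    (fun g : Cp R Omega => (g : continuousType Omega R) w)); first exact: Tc.
  exact: Cp_eval_continuous.
by apply: (Tpos (T c)); exists c.
Qed.

(** A family of positive functionals, indexed by a space on which each vector
    becomes a continuous function, represents [E]; by linearity continuity of
    the representation has to be tested at [0] only. *)
Lemma representation_by_functionals Omega (ev : Omega -> {scalar E}) :
    (forall x, continuous (fun w => ev w x : R)) ->
    (forall w c, C c -> 0 <= ev w c) ->
    (forall x, x != 0 -> exists w, ev w x != 0) ->
    (forall K e, compact K -> 0 < e -> \forall y \near (0 : E),
       K `<=` [set w | `|ev w y| < e]) ->
  exists T : {linear E -> Ck R Omega},
    injective_positive_representation T C (@nonneg_functions R Omega).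
Proof.
move=> evc evC evsep evunif.
pose T0 (x : E) : Ck R Omega := mkcts (evc x).
have T0lin : linear T0.
  by move=> a y z; apply/continuousEP => w; rewrite /T0 /= /mkcts linearP.
pose T0M := GRing.isLinear.Build R E (Ck R Omega) _ T0 T0lin.
pose T : {linear E -> Ck R Omega} := HB.pack T0 T0M.
have TE x w : (T x : continuousType Omega R) w = ev w x by [].
exists T; split.
- apply: Ck_continuous_on_compacts => x K e cK e0.
  have := nbhs_dilation 1 x (evunif K e cK e0).
  apply: filterS => y Ky w /Ky /=.
  by rewrite scale1r linearB distrC.
- move=> x y Txy; apply/eqP; rewrite -subr_eq0; apply/negPn/negP => /evsep[w].
  by rewrite linearB /= -!TE Txy subrr eqxx.
- by move=> _ [c Cc <-] w; rewrite TE; exact: evC.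
Qed.

(** On the dual cone with the discrete topology every function is continuous.
    Its compact subsets are finite, so that smallness on a compact set is
    smallness of finitely many continuous functionals; [near_covering] states
    this compactness in the form used here. *)
Lemma discrete_representation : separates_points (top_dual_cone C) ->
  exists (Omega : topologicalType) (T : {linear E -> Ck R Omega}),
    [/\ locally_compact [set: Omega], hausdorff_space Omega &
        injective_positive_representation T C (@nonneg_functions R Omega)].
Proof.
move=> Csep.
pose Omega := discrete_topology {classic {f : {scalar E} | top_dual_cone C f}}.
pose ev (w : Omega) : {scalar E} := sval w.
have [||||T TP] := @representation_by_functionals Omega ev.
- by move=> x w U; rewrite nbhs_principalE => /nbhs_singleton Uw A /= ->.
- by move=> w c Cc; case: (svalP w) => _; exact.
- by move=> x /Csep[f fC fx]; exists (exist _ f fC).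
- move=> K e /compact_near_coveringP cK e0; apply: cK => w Kw.
  have [fcts _] := svalP w.
  have := fcts 0; rewrite /continuous_at linear0 => /cvgrPdist_lt /(_ e e0) fe.
  exists ([set w], [set y | `|ev w y| < e]); last by move=> [w' y] [/= -> ].
  split=> /=; first exact: discrete_set1.
  by apply: filterS fe => y; rewrite sub0r normrN.
exists Omega, T; split => //.
- move=> w _; rewrite withinET; exists [set w]; first exact: discrete_set1.
  by split; [exact: compact_set1|exact: discrete_closed].
- exact: discrete_hausdorff.
Qed.

End Representations.

(** * Normed spaces *)

Section Compactness.

Lemma compact_set_type (X : topologicalType) (K : set X) :
  compact K -> compact [set: set_type K].
Proof.
move=> cK F FF _.
have [x [Kx Fx]] : K `&` cluster (set_val @ F) !=set0.
  apply: cK; suff : F [set w : set_type K | K (set_val w)] by [].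
  by apply: filterS filterT => w _; exact: set_valP.
exists (exist _ x (mem_set Kx)); split => // A B FA.
move=> [_ [[V Vo <-] Vx] VB].
have : nbhs x V by exact: open_nbhs_nbhs.
have : (set_val @ F) (set_val @` A).
  suff : F [set w : set_type K | (set_val @` A) (set_val w)] by [].
  by apply: filterS FA => w Aw; exists w.
move=> /Fx /[apply] -[_ [[w Aw <-] Vw]].
by exists w; split => //; exact: VB.
Qed.

Lemma hausdorff_by_functions (R : realType) (X : topologicalType) :
  (forall x y : X, x != y ->
     exists2 f : X -> R, continuous f & f x != f y) ->
  hausdorff_space X.
Proof.
move=> Xsep x y xy; apply/eqP/negPn/negP => /Xsep[f fc]; apply/negP; rewrite negbK.
apply/eqP; apply: norm_hausdorff => A B /fc Ax /fc By.
by have [z [Az Bz]] := xy _ _ Ax By; exists (f z).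
Qed.

End Compactness.

Section NormedSpaces.
Context {R : realType} {E : normedModType R} (C : set E).

(** The part of the dual cone in the dual unit ball; continuity is implied by
    the bound. *)
Definition dual_ball : set {scalar E} :=
  [set f | (forall c, C c -> 0 <= f c) /\ forall x, `|f x| <= `|x|].

(** A continuous functional is bounded, so a multiple of it is in the ball. *)
Lemma dual_ball_separates : separates_points (top_dual_cone C) ->
  separates_points dual_ball.
Proof.
move=> Csep x /Csep[f [fcts fC] fx].
have [M M0 fM] : exists2 M : R, 0 < M & forall y, `|f y| <= M * `|y|.
  have /linear_bounded_continuous/linear_boundedP/pinfty_ex_gt0[M M0 fM] := fcts.
  by exists M.
pose g0 (y : E) : R^o := M^-1 * f y.
have g0lin : linear g0.
  move=> a y z; rewrite /g0 linearP mulrDr; congr (_ + _).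
  by rewrite mulrCA.
pose g0M := GRing.isLinear.Build R E R^o _ g0 g0lin.
pose g : {scalar E} := HB.pack g0 g0M.
have gE y : g y = M^-1 * f y by [].
exists g; last by rewrite gE mulf_neq0 // invr_neq0 // gt_eqF.
split=> [c Cc|y]; first by apply: mulr_ge0; [rewrite invr_ge0 ltW|exact: fC].
by rewrite gE normrM gtr0_norm ?invr_gt0 // ler_pdivrMl.
Qed.

Definition dual_ball_norm (x : E) : R := sup [set `|f x| | f in dual_ball].

Let dual_ball0 : dual_ball \0.
Proof. by split => [c _|x] /=; rewrite ?normr0. Qed.

Let dual_ball_has_sup x : has_sup [set `|f x| | f in dual_ball].
Proof.
split; first by exists `|(\0 : {scalar E}) x|; exists \0.
by exists `|x| => _ [f [_ fx] <-].
Qed.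

Let dual_ball_norm_ge f x : dual_ball f -> `|f x| <= dual_ball_norm x.
Proof. by move=> Bf; apply: ub_le_sup; [case: (dual_ball_has_sup x)|exists f]. Qed.

Let dual_ball_norm_le x r : (forall f, dual_ball f -> `|f x| <= r) ->
  dual_ball_norm x <= r.
Proof.
by move=> h; apply: ge_sup => [|_ [f Bf <-]]; [case: (dual_ball_has_sup x)|exact: h].
Qed.

Lemma dual_ball_norm_le_norm x : dual_ball_norm x <= `|x|.
Proof. by apply: dual_ball_norm_le => f [_]. Qed.

Lemma dual_ball_norm_seminorm : seminorm dual_ball_norm.
Proof.
have leZ a x : dual_ball_norm (a *: x) <= `|a| * dual_ball_norm x.
  apply: dual_ball_norm_le => f Bf; rewrite linearZ normrM ler_wpM2l //.
  exact: dual_ball_norm_ge.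
split=> [a x|x y].
  apply/eqP; rewrite eq_le leZ /=; have [->|a0] := eqVneq a 0.
    rewrite normr0 mul0r; apply: le_trans (dual_ball_norm_ge _ dual_ball0).
    exact: normr_ge0.
  rewrite -ler_pdivlMl ?normr_gt0 //; have := leZ a^-1 (a *: x).
  by rewrite scalerA mulVf // scale1r normfV.
apply: dual_ball_norm_le => f Bf; rewrite linearD (le_trans (ler_normD _ _)) //.
by apply: lerD; exact: dual_ball_norm_ge.
Qed.

Lemma dual_ball_norm_full x y z : cone_le C x y -> cone_le C y z ->
  dual_ball_norm y <= Num.max (dual_ball_norm x) (dual_ball_norm z).
Proof.
move=> xy yz; apply: dual_ball_norm_le => f Bf; rewrite le_max.
have := abs_order_interval Bf.1 xy yz; rewrite le_max => /orP[fx|fz].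
  by apply/orP; left; apply: le_trans fx _; exact: dual_ball_norm_ge.
by apply/orP; right; apply: le_trans fz _; exact: dual_ball_norm_ge.
Qed.

Lemma dual_ball_norm_is_norm : separates_points (top_dual_cone C) ->
  is_norm dual_ball_norm.
Proof.
move=> Csep; have [pZ pD] := dual_ball_norm_seminorm.
split=> // [x|x px0]; first exact: seminorm_ge0 dual_ball_norm_seminorm.
apply/eqP/negPn/negP => /(dual_ball_separates Csep)[f Bf].
by rewrite -normr_le0 -px0 dual_ball_norm_ge.
Qed.

Lemma normable_normal_topology : separates_points (top_dual_cone C) ->
  exists tau : topology_on E,
    [/\ coarser_than tau, locally_convex_space (retopologized tau),
        normal_cone (C : set (retopologized tau)) &
        normable (retopologized tau)].
Proof.
move=> Csep; have pnorm := dual_ball_norm_is_norm Csep.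
have Sdir : directed_seminorms [set dual_ball_norm].
  split=> [|p ->|p q -> ->]; first by exists dual_ball_norm.
    exact: dual_ball_norm_seminorm.
  by exists dual_ball_norm.
exists (seminorm_topology Sdir); split.
- apply: seminorm_topology_coarser => p e -> e0.
  have : nbhs (0 : E) (ball 0 e) by exact: nbhsx_ballx.
  apply: filterS => y; rewrite -ball_normE /ball_ /= sub0r normrN.
  exact: le_lt_trans (dual_ball_norm_le_norm y).
- apply: seminorm_locally_convex => x x0; exists dual_ball_norm => //.
  by apply/eqP => px; move/eqP: x0; apply; case: pnorm => _ + _ _; exact.
- by apply: seminorm_normal_cone => p x y z ->; exact: dual_ball_norm_full.
- exists dual_ball_norm => // A.
  have -> : @open (retopologized (seminorm_topology Sdir)) A =
    seminorm_open [set dual_ball_norm] A by [].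
  split=> Ao x /Ao.
    by move=> [_ [e [-> e0 pA]]]; exists e.
  by move=> [r r0 rA]; exists dual_ball_norm, r.
Qed.

Let ptws_eval_continuous (x : E) : continuous (fun g : {ptws E -> R} => g x).
Proof.
move=> g.
have /pointwise_cvgP : {ptws, nbhs (g : {ptws E -> R}) --> (g : E -> R)}.
  exact: cvg_id.
exact.
Qed.

(** [dual_ball] as a set of functions, to be topologized pointwise. *)
Definition dual_ball_functions : set {ptws E -> R} :=
  [set g | [/\ forall a x y, g (a *: x + y) = a * g x + g y,
     forall c, C c -> 0 <= g c & forall x, `|g x| <= `|x|]].

(** Banach-Alaoglu: a closed subset of a product of segments. *)
Lemma dual_ball_functions_compact : compact dual_ball_functions.
Proof.
pose P := [set g : {ptws E -> R} | forall x, `[- `|x|, `|x|]%classic (g x)].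
have cP : compact P.
  exact: (@tychonoff E (fun=> R) (fun x => `[- `|x|, `|x|]%classic)
    (fun x => @segment_compact R _ _)).
have KP : dual_ball_functions `<=` P.
  by move=> g [_ _ g1] x; rewrite /= in_itv /= -ler_norml.
apply: subclosed_compact cP KP.
have -> : dual_ball_functions =
    (\bigcap_(u in [set: R * E * E])
       [set g | g (u.1.1 *: u.1.2 + u.2) - (u.1.1 * g u.1.2 + g u.2) = 0]) `&`
    ((\bigcap_(c in C) [set g | 0 <= g c]) `&`
     (\bigcap_(x in [set: E]) [set g | `|g x| <= `|x|])).
  apply/seteqP; split=> [g [glin gC g1]|g [glin [gC g1]]].
    split; first by move=> [[a x] y] _ /=; rewrite glin subrr.
    by split=> [c Cc|x _]; [exact: gC|exact: g1].
  split=> [a x y|c Cc|x]; [|exact: gC|exact: g1].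
  by apply/eqP; rewrite -subr_eq0; apply/eqP; exact: (glin (a, x, y)).
apply: closedI; last apply: closedI; apply: closed_bigI => u _.
- apply: (@closed_comp {ptws E -> R} R
    (fun g => g (u.1.1 *: u.1.2 + u.2) - (u.1.1 * g u.1.2 + g u.2)) [set 0]).
    move=> g _.
    have g_eval (x : E) : (fun h : {ptws E -> R} => h x) @ g --> g x.
      exact: (@ptws_eval_continuous x g).
    exact: (cvgB (g_eval _) (cvgD (cvgM (cvg_cst _) (g_eval _)) (g_eval _))).
  exact: closed_eq.
- apply: (@closed_comp {ptws E -> R} R (fun g => g u) [set r | 0 <= r]).
    by move=> g _; exact: (@ptws_eval_continuous u g).
  exact: closed_ge.
- apply: (@closed_comp {ptws E -> R} R (fun g => `|g u|) [set r | r <= `|u|]).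
    by move=> g _; exact: (cvg_norm (@ptws_eval_continuous u g)).
  exact: closed_le.
Qed.

(** Evaluation on the dual ball is uniformly bounded by the norm, so the
    representation is continuous for uniform convergence on the whole space. *)
Lemma compact_representation : separates_points (top_dual_cone C) ->
  exists (Omega : topologicalType) (T : {linear E -> Ck R Omega}),
    [/\ compact [set: Omega], hausdorff_space Omega &
        injective_positive_representation T C (@nonneg_functions R Omega)].
Proof.
move=> Csep.
pose Omega := set_type dual_ball_functions.
have OmegaP (w : Omega) : dual_ball_functions (set_val w) by exact: set_valP.
pose ev (w : Omega) : {scalar E} :=
  HB.pack (set_val w : E -> R^o)
    (GRing.isLinear.Build R E R^o _ (set_val w : E -> R^o)
       (let: And3 h _ _ := OmegaP w in h)).
have evE w x : ev w x = (set_val w : E -> R) x by [].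
have evc x : continuous (fun w => ev w x : R).
  move=> w; apply: (@continuous_comp _ _ _ (set_val : Omega -> {ptws E -> R})
    (fun g : {ptws E -> R} => g x)); last exact: ptws_eval_continuous.
  exact: initial_continuous.
have [||||T TP] := @representation_by_functionals R E C Omega ev.
- exact: evc.
- by move=> w c Cc; have [_ + _] := OmegaP w; exact.
- move=> x /(dual_ball_separates Csep)[f [fC f1] fx].
  have Kf : dual_ball_functions (f : E -> R).
    by split => // a y z; rewrite linearP.
  by exists (exist _ (f : E -> R) (mem_set Kf)).
- move=> K e _ e0; have : nbhs (0 : E) (ball 0 e) by exact: nbhsx_ballx.
  apply: filterS => y; rewrite -ball_normE /ball_ /= sub0r normrN => ye w _ /=.
  by apply: le_lt_trans ye; have [_ _] := OmegaP w; exact.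
exists Omega, T; split => //.
  exact: compact_set_type dual_ball_functions_compact.
apply: (@hausdorff_by_functions R) => v w vw.
have [x vwx] : exists x, ev v x != ev w x.
  apply/not_existsP => vw0; move/eqP: vw; apply; apply: val_inj.
  by apply/funext => x; apply/eqP/negPn/negP; exact: vw0.
by exists (fun w => ev w x).
Qed.

End NormedSpaces.

(** * The equivalence *)

Theorem theoremB (R : realType) :
  (forall (E : topologicalLmodType R) (C : set E),
    hausdorff_space E -> convex_cone C ->
    [<-> separates_points (top_dual_cone C);
         separates_points (@top_dual R E) /\ proper_cone (weak_closure C);
         \bigcap_(H in [set H : set E | supporting_hyperplane C H /\ closed H]) H
           = [set 0];
         exists tau : topology_on E,
           [/\ coarser_than tau,
               locally_convex_space (retopologized tau) &
               normal_cone (C : set (retopologized tau))];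
         exists (Omega : topologicalType) (T : {linear E -> Cp R Omega}),
           injective_positive_representation T C
               (@nonneg_functions R Omega);
         exists (Omega : topologicalType) (T : {linear E -> Ck R Omega}),
           [/\ locally_compact [set: Omega], hausdorff_space Omega &
               injective_positive_representation T C
               (@nonneg_functions R Omega)] ])
  /\
  (forall (E : normedModType R) (C : set E),
    convex_cone C -> separates_points (top_dual_cone C) ->
    (exists tau : topology_on E,
       [/\ coarser_than tau,
           locally_convex_space (retopologized tau),
           normal_cone (C : set (retopologized tau)) &
           normable (retopologized tau)]) /\
    (exists (Omega : topologicalType) (T : {linear E -> Ck R Omega}),
       [/\ compact [set: Omega], hausdorff_space Omega &
           injective_positive_representation T C
               (@nonneg_functions R Omega)])).
Proof.
split=> [E C _ Ccone|E C Ccone Csep]; last first.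
  by split; [exact: normable_normal_topology|exact: compact_representation].
tfae.
- exact: separates_proper_weak_closure.
- move=> [_ Cproper]; apply: separates_bigcap_hyperplanes => //.
  exact: proper_weak_closure_separates.
- by move=> /(bigcap_hyperplanes_separates Ccone); exact: normal_topology.
- move=> [tau [tauE LC Cnormal]].
  have := normal_cone_separates Ccone tauE LC Cnormal.
  move=> /discrete_representation[Omega [T [_ _ /Ck_representation_Cp[T' T'P]]]].
  by exists Omega, T'.
- move=> [Omega [T /Cp_representation_separates]].
  exact: discrete_representation.
- move=> [Omega [T [_ _ /Ck_representation_Cp[T' T'P]]]].
  exact: Cp_representation_separates T'P.
Qed.
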